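(* Let $R$ be a ring with unit element. Then $$c_n(R,q)=\sum_{j=0}^n\binom{n}{j}\gamma_j(R,q)$$ for every $n\in\mathbb N$ and every $q\in\{p^k\mid p,k\in\mathbb N,\ p\text{ is prime}\}\cup\{0\}$.
   Context: Rings are associative; $\mathbb N=\{1,2,\dots\}$. $\mathbb Z\langle X\rangle$ is the free associative ring without $1$ on $X=\{x_1,x_2,\dots\}$. $\operatorname{Id}(R,\mathbb Z)\subseteq\mathbb Z\langle X\rangle$ is the set of $f$ with $f(a_1,\dots,a_n)=0$ for all $a_i\in R$. $P_n(\mathbb Z)$ is the additive subgroup of $\mathbb Z\langle X\rangle$ generated by the monomials $x_{\sigma(1)}\cdots x_{\sigma(n)}$, $\sigma\in S_n$. $\Gamma_n(\mathbb Z)\subseteq P_n(\mathbb Z)$ is the subgroup of proper polynomials, i.e. of linear combinations of products of long commutators (of length $\geqslant2$; left normed, e.g. $[x,y,z,t]=[[[x,y],z],t]$); in particular $\Gamma_1(\mathbb Z)=0$. For $n\geqslant1$ the codimensions $c_n(R,q)$ and proper codimensions $\gamma_n(R,q)$ ($q=0$ or a prime power) are the multiplicities in the decompositions of finitely generated abelian groups $$\frac{P_n(\mathbb Z)}{P_n(\mathbb Z)\cap\operatorname{Id}(R,\mathbb Z)}\cong \mathbb Z^{c_n(R,0)}\oplus\bigoplus_{p\text{ prime}}\bigoplus_{k\in\mathbb N}(\mathbb Z/p^k\mathbb Z)^{c_n(R,p^k)},$$ $$\frac{\Gamma_n(\mathbb Z)}{\Gamma_n(\mathbb Z)\cap\operatorname{Id}(R,\mathbb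 Z)}\cong \mathbb Z^{\gamma_n(R,0)}\oplus\bigoplus_{p\text{ prime}}\bigoplus_{k\in\mathbb N}(\mathbb Z/p^k\mathbb Z)^{\gamma_n(R,p^k)}.$$ Moreover, $\gamma_0(R,q)$ is the number of summands $\mathbb Z_q$ ($\mathbb Z_0=\mathbb Z$, $\mathbb Z_q=\mathbb Z/q\mathbb Z$) in the analogous decomposition (into infinite cyclic and primary cyclic groups) of the cyclic additive subgroup of $R$ generated by $1_R$. *)

(* Defs.v *)
From HB Require Import structures.
From mathcomp Require Import all_boot all_fingroup all_algebra.
From mathcomp Require Import boolp classical_sets.
From mathcomp Require Import finmap monalg.
Set Implicit Arguments.
Unset Strict Implicit.
Unset Printing Implicit Defensive.
Import GRing.Theory.
Local Open Scope ring_scope.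

Inductive zspan_prop (V : zmodType) (S : V -> Prop) : V -> Prop :=
| zspan_gen x : S x -> zspan_prop S x
| zspan_zero : zspan_prop S 0
| zspan_sub x y : zspan_prop S x -> zspan_prop S y -> zspan_prop S (x - y).

Definition zspan (V : zmodType) (S : V -> Prop) : {pred V} :=
  fun x => `[< zspan_prop S x >].

Fact zspan_zmod_closed (V : zmodType) (S : V -> Prop) : zmod_closed (zspan S).
Proof.
split=> [|x y /asboolP Sx /asboolP Sy]; apply/asboolP; first exact: zspan_zero.
exact: zspan_sub.
Qed.

HB.instance Definition _ (V : zmodType) (S : V -> Prop) :=
  GRing.isZmodClosed.Build V (zspan S) (zspan_zmod_closed S).

Definition subgI (V : zmodType) (G H : {pred V}) : {pred V} :=
  fun x => (x \in G) && (x \in H).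

Fact subgI_zmod_closed (V : zmodType) (G H : zmodClosed V) :
  zmod_closed (subgI G H).
Proof.
split=> [|x y /andP[Gx Hx] /andP[Gy Hy]]; apply/andP; split;
  by [apply: rpred0 | apply: rpredB].
Qed.

HB.instance Definition _ (V : zmodType) (G H : zmodClosed V) :=
  GRing.isZmodClosed.Build V (subgI G H) (subgI_zmod_closed G H).

Record subg_of (V : zmodType) (G : zmodClosed V) :=
  Subg { subg_val : V; _ : subg_val \in G }.

HB.instance Definition _ (V : zmodType) (G : zmodClosed V) :=
  [isSub for @subg_val V G].
HB.instance Definition _ (V : zmodType) (G : zmodClosed V) :=
  [Choice of subg_of G by <:].
HB.instance Definition _ (V : zmodType) (G : zmodClosed V) :=
  [SubChoice_isSubZmodule of subg_of G by <:].

(* G :&: H, seen inside the group subg_of G. *)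
Definition in_subg (V : zmodType) (G H : zmodClosed V) : {pred subg_of G} :=
  fun x => subg_val x \in H.
Arguments in_subg {V} G H _.

Fact in_subg_zmod_closed (V : zmodType) (G H : zmodClosed V) :
  zmod_closed (in_subg G H).
Proof.
split=> [|x y Hx Hy]; rewrite unfold_in.
  by rewrite -[subg_val 0]/(val 0) raddf0 rpred0.
by rewrite -[subg_val _]/(val (x - y)) raddfB rpredB.
Qed.

HB.instance Definition _ (V : zmodType) (G H : zmodClosed V) :=
  GRing.isZmodClosed.Build (subg_of G) (in_subg G H) (in_subg_zmod_closed G H).

(* The group G / (G :&: H). *)
Definition subg_quot (V : zmodType) (G H : zmodClosed V) : zmodType :=
  Quotient.quot (in_subg G H).

(* Z_0 = Z and Z_q = Z / q Z for q > 0; 'Z_q is avoided because it denotes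
   Z / 2 Z for q = 0 and q = 1. *)
Definition Zmod (q : nat) : zmodType :=
  if q is m.+1 then ('I_m.+1 : zmodType) else (int : zmodType).

(* The direct sum of the Zmod q for q in s; 'I_1 is the zero group. *)
Fixpoint Zmod_sum (s : seq nat) : zmodType :=
  if s is q :: s' then ((Zmod q * Zmod_sum s')%type : zmodType)
  else ('I_1 : zmodType).

Definition zero_or_primepow (q : nat) : Prop :=
  q = 0%N \/ exists p k : nat, [/\ prime p, (0 < k)%N & q = (p ^ k)%N].

Definition primary_decomposition (A : zmodType) (s : seq nat) : Prop :=
  (forall q, q \in s -> zero_or_primepow q) /\
  exists f : {additive A -> Zmod_sum s}, bijective f.

(* The number of summands Z_q in the decomposition of A into infinite cyclic
   and primary cyclic groups. Such a decomposition exists when A is finitely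
   generated and is unique up to the order of the summands, so that the choice
   made by xget is harmless; the default value [::] is only used for groups that
   have no such finite decomposition. *)
Definition multiplicity (A : zmodType) (q : nat) : nat :=
  count_mem q (xget [::] (primary_decomposition A)).

(* The free associative ring with 1 on the variables x_1, x_2, ...; the free ring
   without 1 is its subset of elements with zero constant term. The variable
   x_(i+1) is var i. *)
Notation freeZ := {malg int[{fmonom nat}]}.

Definition var (i : nat) : freeZ := << fmu i >>.

Definition feval (R : pzRingType) (a : nat -> R) (f : freeZ) : R :=
  \sum_(w <- msupp f) (\prod_(i <- (w : seq nat)) a i) *~ f@_w.

(* The polynomial identities of R, taken in the free ring without 1. *)
Definition identities (R : pzRingType) : {pred freeZ} :=
  fun f => (f@_mone == 0) && `[< forall a : nat -> R, feval a f = 0 >].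

Fact feval_zmod_morphism (R : pzRingType) (a : nat -> R) :
  zmod_morphism (feval a).
Proof.
have fevalE (d : {fset {fmonom nat}}) (f : freeZ) : (msupp f `<=` d)%fset ->
    feval a f = \sum_(w <- d) (\prod_(i <- (w : seq nat)) a i) *~ f@_w.
  move=> le; rewrite /feval (big_fset_incl _ le) // => w _ /mcoeff_outdom ->.
  by rewrite mulr0z.
move=> f g; set d := (msupp f `|` msupp g)%fset.
rewrite (fevalE d) ?msuppB_le // (fevalE d f) ?finmap.fsubsetUl //.
rewrite (fevalE d g) ?finmap.fsubsetUr // -sumrB.
by apply: eq_bigr => w _; rewrite mcoeffB mulrzBr.
Qed.

HB.instance Definition _ (R : pzRingType) (a : nat -> R) :=
  GRing.isZmodMorphism.Build freeZ R (feval a) (feval_zmod_morphism a).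

Fact identities_zmod_closed (R : pzRingType) : zmod_closed (identities R).
Proof.
split=> [|f g /andP[/eqP f1 /asboolP fR] /andP[/eqP g1 /asboolP gR]].
  by apply/andP; split; [rewrite mcoeff0 | apply/asboolP=> a; rewrite raddf0].
apply/andP; split; first by rewrite mcoeffB f1 g1 subrr.
by apply/asboolP=> a; rewrite raddfB /= fR gR subrr.
Qed.

HB.instance Definition _ (R : pzRingType) :=
  GRing.isZmodClosed.Build freeZ (identities R) (identities_zmod_closed R).

Definition multilinear_monomial (n : nat) (f : freeZ) : Prop :=
  exists s : 'S_n, f = \prod_(i < n) var (s i).

Definition multilinear_part (n : nat) : zmodClosed freeZ :=
  zspan (multilinear_monomial n).

Definition ring_commutator (f g : freeZ) : freeZ := f * g - g * f.

(* The left normed commutator [x_i1, x_i2, ..., x_ik] for w = [:: i1; ...; ik]. *)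
Definition long_commutator (w : seq nat) : freeZ :=
  if w is i :: w' then foldl (fun f j => ring_commutator f (var j)) (var i) w'
  else 0.

Definition commutator_product (f : freeZ) : Prop :=
  exists ws : seq (seq nat),
    [/\ ws != [::], all (fun w => 2 <= size w)%N ws
      & f = \prod_(w <- ws) long_commutator w].

Definition proper_part (n : nat) : zmodClosed freeZ :=
  subgI (multilinear_part n) (zspan commutator_product).

Definition codim (R : pzRingType) (n q : nat) : nat :=
  multiplicity (subg_quot (multilinear_part n) (identities R)) q.

Definition proper_codim (R : pzRingType) (n q : nat) : nat :=
  if n is 0 then multiplicity (subg_of (zspan (fun x : R => x = 1))) q
  else multiplicity (subg_quot (proper_part n) (identities R)) q.

(* Main.v *)
From HB Require Import structures.
Require Import Defs.
From mathcomp Require Import all_boot perm all_algebra.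
From mathcomp Require Import boolp classical_sets.
From mathcomp Require Import finmap monalg zify.
Set Implicit Arguments.
Unset Strict Implicit.
Unset Printing Implicit Defensive.
Import GRing.Theory.
Local Open Scope ring_scope.

(** The theorem reflects a decomposition of the multilinear polynomials that is
    compatible with identities: every multilinear [f] in [n] variables is uniquely
    a sum, over the sets [S] of variables, of [x_S g_S], where [x_S] is the ordered
    product of the variables in [S] and [g_S] is a proper polynomial in the other
    variables. As [R] has a unit, [f] is an identity if and only if all the [g_S]
    are, because the [g_S] are obtained from [f] by setting variables to 1 and
    subtracting terms found before. There are ['C(n, j)] sets [S] that leave [j]
    variables.

    The decomposition is obtained one variable at a time. Let [mixed_part a b] be
    the group of multilinear polynomials in [a + b] variables that become 0 when
    any one of the last [b] variables is set to 1. A multilinear [f] is the sum of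
    [x_a * (f with x_a := 1)] and of a remainder that vanishes at [x_a := 1]. This
    identifies [mixed_part a.+1 b], modulo identities, with the product of
    [mixed_part a b] and [mixed_part a b.+1] modulo identities
    ([quotient_map_mixed]). Multiplicities add up over products, so they satisfy
    the recursion of Pascal's triangle ([mixed_codimS], [pascal_sum]), and the
    binomial sum drops out, with the groups [mixed_part 0 j] as terms.

    It remains to see that [mixed_part 0 n] is the group of proper polynomials
    ([mixed_part_proper]). A polynomial killed by each [x_k := 1] equals
    [f - x_k * (f with x_k := 1)]; on a word [u x_k v] this operation gives the
    commutator of [u] and [x_k] times [v], so after it has been applied for every
    [k], only products of long commutators are left ([tail_span]). Conversely, a
    long commutator dies when one of its variables becomes 1 ([set_one_proper]).
    For [j = 0], the group is that of the constants, and its quotient is the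
    additive group generated by the unit of [R].

    That multiplicities add up over products rests on the structure theorem for
    finitely generated abelian groups. Existence of primary decompositions
    ([fg_primary_decomposition]) comes from the Smith normal form and the Chinese
    remainder theorem, once subgroups of finitely generated groups are known to be
    finitely generated ([noetherian_zspan]). Uniqueness
    ([primary_decomposition_unique]) is read off the orders of the groups
    [A / p ^ k A]. *)

(** * Presentations of quotient groups *)
Definition whole (V : zmodType) : {pred V} := fun=> true.
Arguments whole : clear implicits.

Fact whole_zmod_closed (V : zmodType) : zmod_closed (whole V).
Proof. by []. Qed.

HB.instance Definition _ (V : zmodType) :=
  GRing.isZmodClosed.Build V (whole V) (whole_zmod_closed V).

(** A map that presents [A] as the quotient of the subgroup [G] by [G :&: H]. The
    domain is all of [V] and only the values on [G] matter; this keeps subtypes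
    out of the way when such maps are composed with maps between ambient groups. *)
Definition quotient_map (V A : zmodType) (G H : {pred V}) (c : V -> A) : Prop :=
  [/\ {in G &, {morph c : x y / x - y}},
      forall a, exists2 x, x \in G & c x = a
    & {in G, forall x, c x = 0 <-> x \in H}].

Lemma quotient_map_eq (V A : zmodType) (G : zmodClosed V) (H : {pred V})
    (c : V -> A) : quotient_map G H c ->
  {in G &, forall x y, c x = c y <-> x - y \in H}.
Proof.
case=> cB _ cH x y Gx Gy; rewrite -cH ?rpredB // cB //.
by split=> [->|/eqP]; rewrite ?subrr // subr_eq0 => /eqP.
Qed.

(** This is how two descriptions of one quotient are compared: lift an element of
    [A] to [G], then push it down to [B]. The result does not depend on the lift
    because two lifts differ by an element of [H]. *)
Lemma quotient_map_iso (V A B : zmodType) (G : zmodClosed V) (H : {pred V})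
    (c : V -> A) (d : V -> B) :
  quotient_map G H c -> quotient_map G H d ->
  exists f : {additive A -> B}, bijective f.
Proof.
move=> qc qd.
have lift (A' B' : zmodType) (c' : V -> A') (d' : V -> B') :
    quotient_map G H c' -> quotient_map G H d' ->
    exists f : A' -> B', {in G, forall x, f (c' x) = d' x}.
  move=> qc' qd'; case: (qc') => _ c'S _.
  have rep a : {x | x \in G /\ c' x = a}.
    by apply: cid; have [x Gx cx] := c'S a; exists x.
  exists (fun a => d' (projT1 (rep a))) => x Gx.
  case: (rep _) => y /= [Gy /(quotient_map_eq qc' Gy Gx) Hyx].
  exact/(quotient_map_eq qd' Gy Gx).
have [f fE] := lift _ _ _ _ qc qd; have [g gE] := lift _ _ _ _ qd qc.
case: (qc) (qd) => [cB cS _] [dB dS _].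
have fB : zmod_morphism f.
  move=> a b; have [x Gx <-] := cS a; have [y Gy <-] := cS b.
  by rewrite -cB // !fE ?rpredB // dB.
pose f' : {additive A -> B} :=
  HB.pack f (GRing.isZmodMorphism.Build A B f fB).
exists f'; exists g => [a|b].
  by have [x Gx <-] := cS a; rewrite /= fE // gE.
by have [x Gx <-] := dS b; rewrite /= gE // fE.
Qed.

Lemma quotient_map_subg_quot (V : zmodType) (G H : zmodClosed V) :
  exists c : V -> subg_quot G H, quotient_map G H c.
Proof.
pose pi (x : subg_of G) : subg_quot G H := (\pi x)%qT.
exists (fun x => pi (insubd 0 x)).
have piB : zmod_morphism pi by move=> x y; rewrite /pi raddfB.
split=> [x y Gx Gy|a|x Gx].
- rewrite -piB; congr pi; apply: val_inj.
  by rewrite raddfB /= !insubdK // rpredB.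
- exists (val (repr a)); first exact: valP.
  by rewrite /pi valKd reprK.
- have -> : (x \in H) = (insubd 0 x \in in_subg G H).
    by rewrite [RHS]unfold_in [subg_val _]insubdK.
  rewrite -[X in X \in in_subg _ _]subr0 Quotient.idealrBE.
  have -> : (0 : subg_quot G H) = pi 0 by rewrite -[0 in RHS](subrr 0) piB subrr.
  by split=> /eqP.
Qed.

(** * Existence of primary decompositions *)

(** The class of 1. Everything about [Zmod q] is then read off the map
    [z |-> Zgen q *~ z] from the integers, uniformly in [q]. *)
Definition Zgen (q : nat) : Zmod q :=
  match q return Zmod q with 0%N => 1 : int | m.+1 => inZp 1 : 'I_m.+1 end.

Lemma quotient_map_Zmod (q : nat) :
  quotient_map (whole int) (dvdz q) (fun z => Zgen q *~ z).
Proof.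
split=> [x y _ _|a|x _]; first exact: mulrzBr.
  case: q a => [|m] a; first by exists a => //; rewrite /= intz.
  exists (a : nat)%:Z => //=; apply: val_inj.
  rewrite -pmulrn Zp_mulrn /= modnMml mul1n modn_small //.
have -> : (Zgen q *~ x = 0) <-> (Zgen q *+ `|x|%N = 0).
  case: x => n; first by rewrite pmulrn.
  rewrite NegzE mulrNz abszN absz_nat.
  rewrite -[Zgen q *~ n.+1]/(Zgen q *+ n.+1).
  by split=> /eqP; rewrite ?oppr_eq0 => /eqP; rewrite // => ->; rewrite oppr0.
have -> : (x \in dvdz q) = (q %| `|x|)%N by [].
case: q => [|m] /=.
  rewrite dvd0n pmulrn intz; split=> [[->]//|/eqP->//].
rewrite Zp_mulrn /=; split=> [/(congr1 val) /=|/eqP e].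
  by rewrite modnMml mul1n => /eqP.
by apply: val_inj; rewrite /= modnMml mul1n.
Qed.

Lemma Zgen_eq0 (q : nat) (z : int) : Zgen q *~ z = 0 <-> (q %| z)%Z.
Proof. by have [_ _ ->] := quotient_map_Zmod q. Qed.

(** The projection of a power of [int] onto a sum of cyclic groups; functions on
    [nat] stand for tuples, and the values beyond [size s] are ignored. *)
Fixpoint Zsum_map (s : seq nat) (v : nat -> int) : Zmod_sum s :=
  match s return Zmod_sum s with
  | [::] => 0
  | q :: s' => (Zgen q *~ v 0%N, Zsum_map s' (v \o S))
  end.

Lemma Zsum_mapB (s : seq nat) (u v : nat -> int) :
  Zsum_map s (fun i => u i - v i) = Zsum_map s u - Zsum_map s v.
Proof.
elim: s u v => [|q s IHs] u v /=; first by rewrite subr0.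
by rewrite mulrzBr (IHs (u \o S) (v \o S)).
Qed.

Lemma Zsum_map_surj (s : seq nat) (a : Zmod_sum s) :
  exists v : nat -> int, Zsum_map s v = a.
Proof.
elim: s a => [|q s IHs] /= a; first by exists (fun=> 0); rewrite [a]ord1.
case: a => a b; have [v <-] := IHs b.
have [_ /(_ a)[z _ <-] _] := quotient_map_Zmod q.
by exists (fun i => if i is j.+1 then v j else z).
Qed.

Lemma Zsum_map_eq0 (s : seq nat) (v : nat -> int) :
  Zsum_map s v = 0 <-> forall i, (i < size s)%N -> (nth 0%N s i %| v i)%Z.
Proof.
elim: s v => [|q s IHs] v /=; first by split.
split=> [[/Zgen_eq0 q0 /IHs s0] [|i] //|dv].
  by rewrite ltnS => /s0.
have -> : Zgen q *~ v 0%N = 0 by apply/Zgen_eq0; apply: (dv 0%N).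
by have -> : Zsum_map s (v \o S) = 0 by apply/IHs => i lt_i; apply: (dv i.+1).
Qed.

Lemma Zmod_sum_cat (s t : seq nat) :
  exists f : {additive (Zmod_sum s * Zmod_sum t)%type -> Zmod_sum (s ++ t)},
    bijective f.
Proof.
elim: s => [|q s [f [g fK gK]]].
  exists [the {additive _ -> _} of snd].
  by exists (fun b => (0, b)) => //= -[a b]; rewrite [a]ord1.
pose h (x : Zmod_sum (q :: s) * Zmod_sum t) : Zmod_sum ((q :: s) ++ t) :=
  (x.1.1, f (x.1.2, x.2)).
have hB : zmod_morphism h.
  move=> [[a b] c] [[a1 b1] c1].
  exact: (congr1 (pair (a - a1)) (raddfB f (b, c) (b1, c1))).
exists (HB.pack h (GRing.isZmodMorphism.Build _ _ h hB) : {additive _ -> _}).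
exists (fun y : Zmod_sum ((q :: s) ++ t) => ((y.1, (g y.2).1), (g y.2).2)) => /=.
  by move=> [[a b] c]; rewrite /h /= fK.
by move=> [a b]; rewrite /h /= -surjective_pairing gK.
Qed.

Lemma additive_bij_inv (A B : zmodType) (f : {additive A -> B}) :
  bijective f -> exists g : {additive B -> A}, bijective g.
Proof.
case=> g fK gK.
have gB : zmod_morphism g.
  by move=> x y; rewrite -[LHS]fK; apply: (can_inj fK); rewrite !gK raddfB !gK.
exists (HB.pack g (GRing.isZmodMorphism.Build _ _ g gB) : {additive _ -> _}).
by exists f.
Qed.

Lemma primary_decomposition_bij (A B : zmodType) (s : seq nat)
    (f : {additive A -> B}) :
  bijective f -> primary_decomposition A s -> primary_decomposition B s.
Proof.
move=> /additive_bij_inv[g gbij] [hs [h hbij]]; split=> //.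
by exists [the {additive _ -> _} of h \o g]; apply: bij_comp.
Qed.

Lemma primary_decomposition_prod (A B : zmodType) (s t : seq nat) :
  primary_decomposition A s -> primary_decomposition B t ->
  primary_decomposition (A * B)%type (s ++ t).
Proof.
move=> [hs [f [f' fK f'K]]] [ht [g [g' gK g'K]]]; split.
  by move=> q; rewrite mem_cat => /orP[/hs|/ht].
have [h hbij] := Zmod_sum_cat s t.
pose k (x : A * B) := (f x.1, g x.2) : (Zmod_sum s * Zmod_sum t)%type.
have kB : zmod_morphism k by move=> x y; rewrite /k /= !raddfB.
pose k' : {additive (A * B)%type -> (Zmod_sum s * Zmod_sum t)%type} :=
  HB.pack k (GRing.isZmodMorphism.Build _ _ k kB).
exists [the {additive _ -> _} of h \o k'].
apply: bij_comp => //; exists (fun x => (f' x.1, g' x.2)) => -[a b] /=.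
  by rewrite fK gK.
by rewrite /k /= f'K g'K.
Qed.

Lemma quotient_map_chinese (a b : nat) : coprime a b ->
  quotient_map (whole int) (dvdz (a * b)%N)
    (fun z => (Zgen a *~ z, Zgen b *~ z) : (Zmod a * Zmod b)%type).
Proof.
move=> co_ab.
have [_ aS _] := quotient_map_Zmod a; have [_ bS _] := quotient_map_Zmod b.
have gB q x y : Zgen q *~ x - Zgen q *~ y = Zgen q *~ (x - y).
  by rewrite mulrzBr.
split=> [x y _ _|[x y]|x _].
- by congr (_, _); rewrite mulrzBr.
- have [i _ <-] := aS x; have [j _ <-] := bS y.
  exists (zchinese a b i j) => //; congr (_, _); apply/eqP.
    rewrite -subr_eq0 gB; apply/eqP/Zgen_eq0; rewrite -eqz_mod_dvd.
    by rewrite zchinese_modl.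
  rewrite -subr_eq0 gB; apply/eqP/Zgen_eq0; rewrite -eqz_mod_dvd.
  by rewrite zchinese_modr.
- rewrite PoszM Gauss_dvdz //; split=> [[/Zgen_eq0-> /Zgen_eq0->]//|].
  by case/andP=> /Zgen_eq0-> /Zgen_eq0->.
Qed.

(** By the Chinese remainder theorem, the part of [d] at its smallest prime factor
    splits off, and induction handles the coprime cofactor. The empty sequence is
    the decomposition of the zero group [Zmod 1]. *)
Lemma Zmod_primary_decomposition (d : nat) :
  exists s, primary_decomposition (Zmod d) s.
Proof.
have pd_self (q : nat) : zero_or_primepow q -> primary_decomposition (Zmod q) [:: q].
  move=> hq; split=> [q'|]; first by rewrite inE => /eqP->.
  pose k (x : Zmod q) := (x, 0) : Zmod_sum [:: q].
  have kB : zmod_morphism k.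
    move=> x y; exact: (congr1 (pair (x - y)) (esym (subrr (0 : 'I_1)))).
  exists (HB.pack k (GRing.isZmodMorphism.Build _ _ k kB) : {additive _ -> _}).
  by exists fst => // -[x y] /=; rewrite /k [y]ord1.
elim/ltn_ind: d => d IHd.
have [->|d_neq0] := eqVneq d 0%N; first by exists [:: 0%N]; apply: pd_self; left.
have [->|d_neq1] := eqVneq d 1%N.
  by exists [::]; split=> //; exists [the {additive _ -> _} of idfun]; exists id.
have d_gt1 : (1 < d)%N by lia.
pose p := pdiv d; have p_pr : prime p by apply: pdiv_prime.
have [u [v [k [d_eq co_uv u_eq u_gt1 [k_gt0 v_gt0]]]]] : exists u v k,
    [/\ d = (u * v)%N, coprime u v, u = (p ^ k)%N, (1 < u)%N
      & (0 < k)%N /\ (0 < v)%N].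
  have k_gt0 : (0 < logn p d)%N by rewrite logn_gt0 mem_primes p_pr pdiv_dvd ltnW.
  exists (d`_p)%N, (d`_p^')%N, (logn p d).
  rewrite partnC ?(ltnW d_gt1) // coprime_partC p_part part_gt0; split=> //.
  exact: leq_trans (prime_gt1 p_pr) (leq_pexp2l (prime_gt0 p_pr) k_gt0).
have [s sP] : exists s, primary_decomposition (Zmod v) s.
  by apply: IHd; rewrite d_eq ltn_Pmull.
have uP : primary_decomposition (Zmod u) [:: u].
  by apply: pd_self; right; exists p, k.
have [f fbij] : exists f : {additive (Zmod u * Zmod v)%type -> Zmod d}, bijective f.
  apply: quotient_map_iso (quotient_map_chinese co_uv) _.
  by rewrite -d_eq; exact: quotient_map_Zmod.
exists ([:: u] ++ s)%N.
exact: primary_decomposition_bij fbij (primary_decomposition_prod uP sP).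
Qed.

Notation seq_span l := (zspan (fun x => x \in l)).

Lemma mem_zspan (V : zmodType) (S : V -> Prop) (x : V) : S x -> x \in zspan S.
Proof. by move=> Sx; apply/asboolP; apply: zspan_gen. Qed.

Lemma zspan_subset (V : zmodType) (S : V -> Prop) (G : zmodClosed V) :
  (forall x, S x -> x \in G) -> {subset zspan S <= G}.
Proof.
move=> sSG x /asboolP; elim=> [y /sSG //||y z _ Gy _ Gz]; first exact: rpred0.
exact: rpredB.
Qed.

Lemma int_subgroup_principal (J : {pred int}) : zmod_closed J ->
  exists2 d, d \in J & {in J, forall z, (d %| z)%Z}.
Proof.
move=> clJ; pose J' : zmodClosed int := HB.pack J (GRing.isZmodClosed.Build _ J clJ).
pose P (n : nat) := (0 < n)%N && (n%:Z \in J').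
have [exP|noJ] := pselect (exists n, P n); last first.
  exists 0 => [|z Jz]; first exact: (rpred0 J').
  rewrite dvd0z; apply: contraT => z_neq0; case: noJ; exists `|z|%N.
  rewrite /P absz_gt0 z_neq0 /=; case: (z) Jz => i Ji //.
  by move: Ji; rewrite NegzE abszN -[_ \in J]/(_ \in J') rpredN.
case: (ex_minnP exP) => d /andP[d_gt0 Jd] d_min.
exists d%:Z => // z Jz; apply/dvdz_mod0P/eqP; apply: contraT => mod_neq0.
have Jmod : (z %% d)%Z \in J'.
  have -> : (z %% d)%Z = z - d%:Z *~ (z %/ d)%Z.
    by apply/eqP; rewrite mulrzz mulrC eq_sym subr_eq addrC -divz_eq.
  by rewrite rpredB // rpredMz.
have mod_ge0 : 0 <= (z %% d)%Z by rewrite modz_ge0 //; lia.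
have mod_lt : (z %% d)%Z < d by rewrite ltz_pmod.
have /d_min : P `|(z %% d)%Z|%N.
  by rewrite /P absz_gt0 mod_neq0 gez0_abs.
by lia.
Qed.

Lemma subrACA (V : zmodType) (a b c d : V) : a - b - (c - d) = a - c - (b - d).
Proof. by rewrite !opprB [d - c]addrC addrACA [- b + d]addrC. Qed.

Lemma zspan_cons (V : zmodType) (g : V) (l : seq V) (x : V) :
  x \in seq_span (g :: l) -> exists z : int, x - g *~ z \in seq_span l.
Proof.
move/asboolP; elim=> [y||y y' _ [z yz] _ [z' yz']].
- rewrite inE => /orP[/eqP->|ly].
    by exists 1; rewrite subrr rpred0.
  by exists 0; rewrite mulr0z subr0; apply: mem_zspan.
- by exists 0; rewrite mulr0z subr0 rpred0.
- by exists (z - z'); rewrite mulrzBr subrACA rpredB.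
Qed.

(** The coefficients along the first generator [g] of the elements of [H] form an
    ideal of the integers, generated by some [d]. An element [h] of [H] with
    coefficient [d] reduces every element of [H] to one of [H] in the span of the
    other generators. *)
Lemma noetherian_zspan (V : zmodType) (l : seq V) (H : zmodClosed V) :
  (forall x, x \in H -> x \in seq_span l) ->
  exists l' : seq V, forall x, (x \in H) = (x \in seq_span l').
Proof.
elim: l H => [|g l IHl] H sHl.
  exists [::] => x; apply/idP/idP => [/sHl //|].
  by apply: zspan_subset => y.
pose J : {pred int} := fun z =>
  `[< exists2 x, x \in H & x - g *~ z \in seq_span l >].
have clJ : zmod_closed J.
  split=> [|z z' /asboolP[x Hx xz] /asboolP[x' Hx' xz']]; apply/asboolP.
    exists 0; first exact: rpred0.
    by rewrite mulr0z subr0 rpred0.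
  exists (x - x'); first exact: rpredB.
  by rewrite mulrzBr subrACA rpredB.
have [d /asboolP[h Hh hd] dJ] := int_subgroup_principal clJ.
have [|l' l'P] := IHl (subgI H (seq_span l) : zmodClosed V).
  by move=> x /andP[].
exists (h :: l') => x; apply/idP/idP => [Hx|]; last first.
  apply: zspan_subset => y; rewrite inE => /orP[/eqP->//|l'y].
  have : y \in seq_span l' by apply: mem_zspan.
  by rewrite -l'P => /andP[].
have [z xz] := zspan_cons (sHl _ Hx).
have /dJ/dvdzP[c zE] : z \in J by apply/asboolP; exists x.
have : x - h *~ c \in seq_span l'.
  rewrite -l'P; apply/andP; split; first by rewrite rpredB // rpredMz.
  (* [z = c * d], so the multiples of [g] cancel *)
  have -> : x - h *~ c = (x - g *~ z) - (h - g *~ d) *~ c.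
    by rewrite mulrzBl zE mulrzA_C opprB addrA subrK.
  by rewrite rpredB // rpredMz.
move=> xc; rewrite -[x](subrK (h *~ c)) rpredD //.
  apply: zspan_subset xc => y l'y; apply: mem_zspan.
  by rewrite inE [X in _ || X]l'y orbT.
by rewrite rpredMz // mem_zspan // mem_head.
Qed.

Lemma zspan_comb (V : zmodType) (l : seq V) (x : V) :
  x \in seq_span l ->
  exists u : 'rV[int]_(size l), x = \sum_(i < size l) l`_i *~ u 0 i.
Proof.
move/asboolP; elim=> [y ly||y y' _ [u ->] _ [u' ->]].
- have lt_y : (index y l < size l)%N by rewrite index_mem.
  exists (delta_mx 0 (Ordinal lt_y)).
  rewrite (bigD1 (Ordinal lt_y)) //= mxE !eqxx nth_index // big1 ?addr0 //.
  by move=> i /negPf ne_i; rewrite mxE ne_i andbF.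
- by exists 0; rewrite big1 // => i _; rewrite mxE.
- exists (u - u'); rewrite -sumrB; apply: eq_bigr => i _.
  by rewrite !mxE mulrzBr.
Qed.

(** The entries of a row vector, extended by 0 so as to be fed to [Zsum_map]. *)
Definition row_fun (m : nat) (w : 'rV[int]_m) (j : nat) : int :=
  if insub j is Some i then w 0 i else 0.

Lemma row_funE (m : nat) (w : 'rV[int]_m) (j : 'I_m) : row_fun w j = w 0 j.
Proof. by rewrite /row_fun valK. Qed.

(** [K] is the row space of an integer matrix, as it is finitely generated. In the
    coordinates given by the right factor [W] of its Smith normal form, [K] is cut
    out by divisibility of each coordinate by a diagonal entry, so the quotient is
    a sum of cyclic groups. *)
Lemma rV_quotient (m : nat) (K : zmodClosed 'rV[int]_m) :
  exists (s : seq nat) (c : 'rV[int]_m -> Zmod_sum s), quotient_map (whole _) K c.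
Proof.
have [l lP] : exists l : seq 'rV[int]_m, forall x, (x \in K) = (x \in seq_span l).
  apply: (noetherian_zspan (l := [seq delta_mx 0 j | j : 'I_m])) => v _.
  rewrite [v]row_sum_delta; apply: rpred_sum => j _.
  rewrite -[v 0 j]intz scaler_int rpredMz //; apply: mem_zspan.
  by apply: map_f; rewrite mem_enum.
pose r := size l; pose M := \matrix_(i < r, j < m) l`_i 0 j.
have KM v : v \in K <-> exists u, v = u *m M.
  have comb (u : 'rV[int]_r) : u *m M = \sum_(i < r) l`_i *~ u 0 i.
    rewrite mulmx_sum_row; apply: eq_bigr => i _.
    rewrite -scaler_int intz; congr (_ *: _).
    by apply/rowP=> j; rewrite !mxE.
  rewrite lP; split=> [/zspan_comb[u ->]|[u ->]]; first by exists u; rewrite comb.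
  rewrite comb; apply: rpred_sum => i _; rewrite rpredMz //; apply: mem_zspan.
  exact: mem_nth.
have [L uL [W uW [d _ ME]]] := int_Smith_normal_form M.
set D := (\matrix_(i, j) _) in ME.
(* without a row [j] in the Smith form, coordinate [j] of [K] is 0 *)
pose e (j : nat) : int := if (j < r)%N then d`_j else 0.
pose s := mkseq (fun j => `|e j|%N) m.
pose c v := Zsum_map s (row_fun (v *m invmx W)).
have KD v : v \in K <-> forall j : 'I_m, (e j %| (v *m invmx W)%R 0%R j)%Z.
  rewrite KM; split=> [[u ->] j|ev].
    rewrite ME !mulmxA mulmxK // [_ 0 j]mxE; apply: (big_ind (fun z => (e j %| z)%Z)).
    - exact: dvdz0.
    - by move=> x y ex ey; apply: rpredD.
    move=> i _; rewrite [D _ _]mxE /e.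
    case: (eqVneq (i : nat) j) => [<-|ne_ij].
      by rewrite ltn_ord mulr1n dvdz_mull.
    by rewrite mulr0n mulr0 dvdz0.
  pose u : 'rV[int]_r := \row_i (row_fun (v *m invmx W) i %/ d`_i)%Z.
  exists (u *m invmx L); rewrite ME !mulmxA mulmxKV //.
  rewrite -[v in LHS](mulmxKV uW); congr (_ *m _); apply/rowP=> j.
  rewrite [RHS]mxE; have [lt_jr|le_rj] := ltnP j r; last first.
    rewrite big1 => [|i _].
      have := ev j; rewrite /e ltnNge le_rj /= dvd0z => /eqP //.
    rewrite !mxE; have /negPf-> : (i != j :> nat); last by rewrite mulr0n mulr0.
    by apply: contraTneq (ltn_ord i) => ->; rewrite -leqNgt.
  rewrite (bigD1 (Ordinal lt_jr)) //= big1 => [|i ne_ij]; last first.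
    rewrite !mxE; have /negPf-> : (i != j :> nat); last by rewrite mulr0n mulr0.
    by [].
  rewrite addr0 [D _ _]mxE [u _ _]mxE eqxx mulr1n /= row_funE.
  by have := ev j; rewrite /e lt_jr => /divzK ->.
exists s, c; split=> [x y _ _|a|v _].
- rewrite /c -Zsum_mapB mulmxBl; congr Zsum_map; apply: funext => j.
  by rewrite /row_fun; case: insub => [i|]; rewrite ?subr0 // !mxE.
- have [f <-] := Zsum_map_surj a; exists ((\row_i f i) *m W) => //.
  apply/eqP; rewrite -subr_eq0 -Zsum_mapB; apply/eqP/Zsum_map_eq0 => i.
  rewrite size_mkseq => lt_im; rewrite mulmxK // -[i]/(val (Ordinal lt_im)).
  by rewrite row_funE mxE subrr dvdz0.
- rewrite KD /c Zsum_map_eq0 size_mkseq; split=> ev j.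
    have := ev j (ltn_ord j); rewrite nth_mkseq // row_funE.
    by rewrite dvdzE.
  move=> lt_jm; have := ev (Ordinal lt_jm); rewrite nth_mkseq //= -row_funE.
  by rewrite !dvdzE.
Qed.

Lemma Zmod_sum_primary_decomposition (s : seq nat) :
  exists t, primary_decomposition (Zmod_sum s) t.
Proof.
elim: s => [|q s [t tP]].
  by exists [::]; split=> //; exists [the {additive 'I_1 -> 'I_1} of idfun]; exists id.
have [u uP] := Zmod_primary_decomposition q.
by exists (u ++ t); apply: primary_decomposition_prod.
Qed.

Lemma fg_primary_decomposition (V A : zmodType) (G H : zmodClosed V)
    (c : V -> A) (l : seq V) :
  quotient_map G H c -> (forall x, x \in G -> x \in seq_span l) ->
  exists s, primary_decomposition A s.
Proof.
move=> qc /noetherian_zspan[l' Gl']; case: (qc) => cB cS cH.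
pose comb (v : 'rV[int]_(size l')) : V := \sum_(i < size l') l'`_i *~ v 0 i.
have combG v : comb v \in G.
  rewrite Gl'; apply: rpred_sum => i _; rewrite rpredMz // mem_zspan //.
  exact: mem_nth.
have combB : zmod_morphism comb.
  move=> u v; rewrite /comb -sumrB; apply: eq_bigr => i _.
  by rewrite !mxE mulrzBr.
pose K : {pred 'rV[int]_(size l')} := fun v => comb v \in H.
have clK : zmod_closed K.
  split=> [|u v Ku Kv]; rewrite unfold_in; last by rewrite combB rpredB.
  by rewrite -(subrr 0) combB subrr rpred0.
pose K' : zmodClosed _ := HB.pack K (GRing.isZmodClosed.Build _ K clK).
have qcK : quotient_map (whole _) K' (c \o comb).
  split=> [u v _ _|a|v _] /=; first by rewrite combB cB.
  - have [x Gx <-] := cS a; move: Gx; rewrite Gl' => /zspan_comb[v ->].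
    by exists v.
  - by rewrite cH.
have [s [d qd]] := rV_quotient K'.
have [f fbij] := quotient_map_iso qd qcK.
have [t tP] := Zmod_sum_primary_decomposition s.
by exists t; apply: primary_decomposition_bij fbij tP.
Qed.

(** * Uniqueness of primary decompositions *)

(** [A / m A] has [N] elements. The quotient is replaced by a surjection onto a
    finite type with the right fibres, so that [N] is visibly an invariant. *)
Definition mod_index (m : nat) (A : zmodType) (N : nat) : Prop :=
  exists (T : finType) (c : A -> T),
    [/\ #|T| = N, forall t, exists a, c a = t
      & forall x y, c x = c y <-> exists z, x - y = z *+ m].

Lemma mod_index_unique (m : nat) (A B : zmodType) (f : {additive A -> B})
    (M N : nat) :
  bijective f -> mod_index m A M -> mod_index m B N -> M = N.
Proof.
move=> fbij [T [c [<- cS cE]]] [U [d [<- dS dE]]].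
have [f' fK f'K] := fbij.
have cd x y : c x = c y <-> d (f x) = d (f y).
  rewrite cE dE; split=> -[z xyz].
    by exists (f z); rewrite -raddfB xyz raddfMn.
  by exists (f' z); apply: (can_inj fK); rewrite raddfB xyz raddfMn f'K.
have cR t : {a | c a = t} by apply: cid; have [a] := cS t; exists a.
have dR u : {b | d b = u} by apply: cid; have [b] := dS u; exists b.
apply: (bij_eq_card (f := fun t => d (f (sval (cR t))))).
exists (fun u => c (f' (sval (dR u)))) => [t|u].
- case: (cR t) => a /= ca; case: (dR _) => b /= db.
  by rewrite -ca; apply/cd; rewrite f'K.
- case: (dR u) => b /= db; case: (cR _) => a /= /cd ->.
  by rewrite f'K.
Qed.

(** [m] and [q] together generate the ideal of their gcd, so [Zmod q] modulo [m]
    is the group of integers modulo [gcdn q m]; for [q = 0] this is [m]. *)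
Lemma Zmod_mod_index (m q : nat) : (0 < m)%N -> mod_index m (Zmod q) (gcdn q m).
Proof.
move=> m_gt0; pose g := gcdn q m.
have g_gt0 : (0 < g)%N by rewrite gcdn_gt0 m_gt0 orbT.
have [_ qS _] := quotient_map_Zmod q.
have qE z z' : Zgen q *~ z = Zgen q *~ z' <-> (q %| z - z')%Z.
  by rewrite (quotient_map_eq (quotient_map_Zmod q)).
have rep a : {z | Zgen q *~ z = a} by apply: cid; have [z] := qS a; exists z.
have lt_g z : (`|(z %% g)%Z|%N < g)%N.
  rewrite -ltz_nat gez0_abs ?modz_ge0 ?ltz_pmod //; lia.
have modE z z' : Ordinal (lt_g z) = Ordinal (lt_g z') <-> (g %| z - z')%Z.
  rewrite -eqz_mod_dvd; split=> [[e]|/eqP e]; last by apply: val_inj; rewrite /= e.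
  by apply/eqP; rewrite -[LHS]gez0_abs ?modz_ge0 ?e ?gez0_abs ?modz_ge0 //; lia.
exists 'I_g, (fun a => Ordinal (lt_g (sval (rep a)))).
split=> [|t|x y]; first exact: card_ord.
- exists (Zgen q *~ (t : nat)); apply: val_inj => /=.
  case: (rep _) => z /= /qE qz.
  have /eqP -> : (z == (t : nat)%:Z %[mod g])%Z.
    by rewrite eqz_mod_dvd; apply: dvdz_trans qz; rewrite dvdzE dvdn_gcdl.
  by rewrite modz_nat absz_nat modn_small.
- rewrite modE; case: (rep x) => z /= <-; case: (rep y) => z' /= <-.
  split=> [/dvdzP[c zc]|[w]].
    have [u [v uv]] := Bezoutz q m.
    exists (Zgen q *~ (c * v)); rewrite -mulrzBr pmulrn -mulrzA; apply/qE.
    apply/dvdzP; exists (c * u); rewrite zc -[g%:Z]/(gcdz q m) -uv.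
    by rewrite mulrDr !mulrA addrK.
  have [v _ <-] := qS w; rewrite -mulrzBr pmulrn -mulrzA => /qE qd.
  rewrite -(subrK (v * m) (z - z')) rpredD //.
    by apply: dvdz_trans qd; rewrite dvdzE dvdn_gcdl.
  by apply: dvdz_mull; rewrite dvdzE dvdn_gcdr.
Qed.

Lemma Zmod_sum_mod_index (m : nat) (s : seq nat) : (0 < m)%N ->
  mod_index m (Zmod_sum s) (\prod_(q <- s) gcdn q m)%N.
Proof.
move=> m_gt0; elim: s => [|q s [T [c [cN cS cE]]]].
  exists 'I_1, id; rewrite big_nil card_ord; split=> [//|t|x y]; first by exists t.
  by rewrite [x]ord1 [y]ord1; split=> // _; exists 0; rewrite mul0rn subrr.
have [U [d [dN dS dE]]] := Zmod_mod_index q m_gt0.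
exists (U * T)%type, (fun x : Zmod_sum (q :: s) => (d x.1, c x.2)).
rewrite card_prod big_cons cN dN; split=> // [[u t]|[x1 x2] [y1 y2]] /=.
  by have [a <-] := dS u; have [b <-] := cS t; exists (a, b).
have pairMn (z : (Zmod q * Zmod_sum s)%type) : z *+ m = (z.1 *+ m, z.2 *+ m).
  by rewrite [LHS]surjective_pairing !raddfMn.
split=> [[/dE[z1 e1] /cE[z2 e2]]|[z]].
  by exists (z1, z2); rewrite pairMn /= -e1 -e2.
rewrite pairMn => -[e1 e2].
by congr (_, _); [apply/dE; exists z.1 | apply/cE; exists z.2].
Qed.

(** The order of [A / m A] is the product of the [gcdn r m] over the summands
    [Zmod r]. For [m = p ^ k] its [p]-adic valuation is the sum over [r] of
    [e p k r], which is [k] if [r = 0] and [minn (logn p r) k] otherwise. As a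
    function of [k], the term of [r] is concave with a single kink, at [logn p r],
    so the second difference at [k] counts the summands of order [p ^ k]; for
    large [k] only the infinite cyclic summands still contribute to the first
    difference, which counts them. *)
Lemma primary_decomposition_unique (A : zmodType) (s t : seq nat) (q : nat) :
  primary_decomposition A s -> primary_decomposition A t ->
  zero_or_primepow q -> count_mem q s = count_mem q t.
Proof.
move=> [sq [f fbij]] [tq [g gbij]] hq.
have [f' f'bij] := additive_bij_inv fbij.
have prodE m : (0 < m)%N ->
    (\prod_(r <- s) gcdn r m = \prod_(r <- t) gcdn r m)%N.
  move=> m_gt0.
  apply: (mod_index_unique (f := [the {additive _ -> _} of g \o f']) (m := m));
    try exact: Zmod_sum_mod_index.
  exact: bij_comp.
pose e p k r := logn p (gcdn r (p ^ k)).
have sumE p k : prime p -> (\sum_(r <- s) e p k r = \sum_(r <- t) e p k r)%N.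
  move=> p_pr; have pk_gt0 : (0 < p ^ k)%N by rewrite expn_gt0 prime_gt0.
  have lognE u :
      (\sum_(r <- u) e p k r = logn p (\prod_(r <- u) gcdn r (p ^ k)))%N.
    elim: u => [|r u IHu]; first by rewrite !big_nil logn1.
    rewrite !big_cons IHu lognM ?gcdn_gt0 ?pk_gt0 ?orbT //.
    by rewrite prodn_gt0 // => i; rewrite gcdn_gt0 pk_gt0 orbT.
  by rewrite !lognE prodE.
have e0 p k : prime p -> e p k 0%N = k by move=> p_pr; rewrite /e gcd0n pfactorK.
have en0 p k r : prime p -> (0 < r)%N -> e p k r = minn (logn p r) k.
  move=> p_pr r_gt0; have pk_gt0 : (0 < p ^ k)%N by rewrite expn_gt0 prime_gt0.
  by rewrite /e logn_gcd // pfactorK.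
have countE u : count_mem q u = (\sum_(r <- u) (r == q))%N.
  by rewrite -sum1_count big_mkcond /=; apply: eq_bigr => r _; case: eqP.
have sub_s : {subset s <= s ++ t} by move=> r; rewrite mem_cat => ->.
have sub_t : {subset t <= s ++ t} by move=> r; rewrite mem_cat orbC => ->.
case: hq => [q0|[p [k [p_pr k_gt0 qE]]]].
(* any [K] above the 2-adic valuation of all positive orders would do *)
- pose K := (\sum_(r <- s ++ t) r)%N.
  have le_K r : r \in s ++ t -> (r <= K)%N.
    by move=> st_r; rewrite /K (big_rem r) //= leq_addr.
  have step u : {subset u <= s ++ t} ->
      (\sum_(r <- u) e 2 K.+1 r = count_mem q u + \sum_(r <- u) e 2 K r)%N.
    move=> uK; rewrite countE -big_split /=; apply: eq_big_seq => r /uK/le_K le_rK.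
    rewrite q0; have [->|r_neq0] := eqVneq r 0%N; first by rewrite !e0.
    have r_gt0 : (0 < r)%N by rewrite lt0n.
    have lt_K := leq_trans (ltn_logl 2 r_gt0) le_rK.
    by rewrite !en0 // (minn_idPl (ltnW lt_K)) (minn_idPl (leqW (ltnW lt_K))).
  by have := step s sub_s; rewrite !sumE // (step t sub_t) => /addIn->.
- have p_gt1 := prime_gt1 p_pr.
  (* minus the second difference at [k], stated without subtraction *)
  have step u : {subset u <= s ++ t} ->
     (\sum_(r <- u) e p k.-1 r + \sum_(r <- u) e p k.+1 r + count_mem q u =
      (\sum_(r <- u) e p k r).*2)%N.
    move=> ust; rewrite countE -!big_split -muln2 big_distrl /=.
    apply: eq_big_seq => r /ust; rewrite mem_cat => rst.
    have : zero_or_primepow r by case/orP: rst => [/sq|/tq].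
    case=> [->|[p' [j [p'_pr j_gt0 rE]]]].
      rewrite !e0 // qE eq_sym expn_eq0; lia.
    have r_gt0 : (0 < r)%N by rewrite rE expn_gt0 prime_gt0.
    have -> : (r == q) = (logn p r == k).
      apply/eqP/eqP => [->|]; first by rewrite qE pfactorK.
      rewrite qE rE lognX logn_prime //.
      case: eqVneq => [<-|_]; first by rewrite muln1 => ->.
      by rewrite muln0 => k0; move: k_gt0; rewrite -k0.
    by rewrite !en0 //; lia.
  by have := step s sub_s; rewrite !sumE // -(step t sub_t) => /addnI.
Qed.

(** * Multiplicities *)

Lemma multiplicityE (A : zmodType) (s : seq nat) (q : nat) :
  zero_or_primepow q -> primary_decomposition A s -> multiplicity A q = count_mem q s.
Proof.
move=> hq sP; have chosenP := xgetPex [::] (ex_intro _ s sP).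
exact: primary_decomposition_unique chosenP sP hq.
Qed.

Lemma multiplicity_prod (A B : zmodType) (s t : seq nat) (q : nat) :
  zero_or_primepow q -> primary_decomposition A s -> primary_decomposition B t ->
  multiplicity (A * B)%type q = (multiplicity A q + multiplicity B q)%N.
Proof.
move=> hq sP tP.
rewrite (multiplicityE hq sP) (multiplicityE hq tP) -count_cat.
exact/multiplicityE/primary_decomposition_prod.
Qed.

(** Isomorphic groups have the same primary decompositions, hence the same choice
    among them. *)
Lemma multiplicity_quotient (V A B : zmodType) (G : zmodClosed V)
    (H : {pred V}) (c : V -> A) (d : V -> B) (q : nat) :
  quotient_map G H c -> quotient_map G H d ->
  multiplicity A q = multiplicity B q.
Proof.
move=> qc qd; have [f fbij] := quotient_map_iso qc qd.
have [g gbij] := quotient_map_iso qd qc.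
rewrite /multiplicity; congr (count_mem q (xget _ _)).
apply: funext => s; apply: propext; split.
  exact: primary_decomposition_bij fbij.
exact: primary_decomposition_bij gbij.
Qed.

Lemma eq_quotient_map (V A : zmodType) (G G' H H' : {pred V}) (c : V -> A) :
  G =i G' -> {in G, H =i H'} -> quotient_map G H c -> quotient_map G' H' c.
Proof.
move=> eqG eqH [cB cS cH]; split=> [x y|a|x]; rewrite -?eqG; first exact: cB.
  by have [x Gx cx] := cS a; exists x; rewrite -?eqG.
by move=> Gx; rewrite cH // eqH.
Qed.

(** * Substitutions in the free ring *)

(** Words generate the additive group of the free ring. *)
Lemma freeZ_ind (P : freeZ -> Prop) :
  (forall w : {fmonom nat}, P << w >>) -> P 0 ->
  (forall x y, P x -> P y -> P (x - y)) -> forall f, P f.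
Proof.
move=> PU P0 PB f.
have /asboolP : f \in zspan (fun x => exists w : {fmonom nat}, x = << w >>).
  rewrite [f]monalgE; apply: rpred_sum => w _.
  rewrite -[f@_w]intz raddfMz rpredMz //.
  by apply: mem_zspan; exists w.
by elim=> [x [w ->]||x y _ Px _ Py] //; apply: PB.
Qed.

Lemma feval_monomial (R : pzRingType) (a : nat -> R) (w : {fmonom nat}) :
  feval a << w >> = \prod_(i <- (w : seq nat)) a i.
Proof. by rewrite /feval msuppU1 big_seq_fset1 mcoeffUU mulr1z. Qed.

Fact feval_monoid_morphism (R : pzRingType) (a : nat -> R) :
  monoid_morphism (feval a).
Proof.
have fB := feval_zmod_morphism a.
split=> [|f g]; first by rewrite feval_monomial fm1 big_nil.
elim/freeZ_ind: f => [u||x y ex ey].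
- elim/freeZ_ind: g => [v||x y ex ey].
  + by rewrite malgM_def fgmulUU mulr1 !feval_monomial fmM big_cat.
  + by rewrite mulr0 raddf0 mulr0.
  + rewrite [X in feval a X = _]mulrBr [LHS]fB [X in _ = _ * X]fB [RHS]mulrBr.
    by congr (_ - _).
- by rewrite mul0r raddf0 mul0r.
- rewrite [X in feval a X = _]mulrBl [LHS]fB [X in _ = X * _]fB [RHS]mulrBl.
  by congr (_ - _).
Qed.

HB.instance Definition _ (R : pzRingType) (a : nat -> R) :=
  GRing.isMonoidMorphism.Build freeZ R (feval a) (feval_monoid_morphism a).

Lemma feval_var (R : pzRingType) (a : nat -> R) (i : nat) : feval a (var i) = a i.
Proof. by rewrite feval_monomial fmU big_seq1. Qed.

Lemma monomialE (w : {fmonom nat}) : << w >> = \prod_(i <- (w : seq nat)) var i.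
Proof.
case: w => w /=; elim: w => [|i w IHw]; first by rewrite big_nil -fmoneE.
rewrite big_cons -IHw malgM_def fgmulUU mulr1 /var; congr << _ >>.
by apply: val_inj; rewrite /= fmM fmU.
Qed.

(** The uniqueness half of the universal property of the free ring; identities
    between substitutions are checked on variables with it. *)
Lemma rmorph_freeZ_eq (R : pzRingType) (f g : {rmorphism freeZ -> R}) :
  (forall i, f (var i) = g (var i)) -> f =1 g.
Proof.
move=> fg; elim/freeZ_ind=> [w||x y fx fy].
- by rewrite monomialE !rmorph_prod; apply: eq_bigr => i _.
- by rewrite !rmorph0.
- by rewrite !rmorphB fx fy.
Qed.

Lemma feval_feval (R : pzRingType) (a : nat -> R) (v : nat -> freeZ) (f : freeZ) :
  feval a (feval v f) = feval (fun i => feval a (v i)) f.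
Proof.
rewrite -[LHS]/((feval a \o feval v) f).
by apply: rmorph_freeZ_eq => i; rewrite /= !feval_var.
Qed.

Definition word (w : seq nat) : freeZ := \prod_(i <- w) var i.

Lemma word_multilinear (n : nat) (w : seq nat) :
  perm_eq w (iota 0 n) -> word w \in multilinear_part n.
Proof.
move=> pw; apply: mem_zspan.
have sz : size w = n by rewrite (perm_size pw) size_iota.
have lt_w (i : 'I_n) : (nth 0%N w i < n)%N.
  have := mem_nth 0%N (s := w) (n := i).
  by rewrite sz ltn_ord (perm_mem pw) mem_iota; apply.
have inj : injective (fun i => Ordinal (lt_w i)).
  move=> i j [/eqP]; rewrite nth_uniq ?sz ?ltn_ord //; first by move/eqP/val_inj.
  by rewrite (perm_uniq pw) iota_uniq.
exists (perm inj); rewrite /word (big_nth 0%N) sz big_mkord; apply: eq_bigr => i _.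
by rewrite permE.
Qed.

(** Words that are rearrangements of [iota 0 n] are handier than permutations of
    ['I_n], since deleting or inserting a letter stays within words. *)
Lemma multilinear_partP (n : nat) (f : freeZ) :
  f \in multilinear_part n ->
  f \in zspan (fun x => exists2 w, perm_eq w (iota 0 n) & x = word w).
Proof.
apply: zspan_subset => x [s ->]; apply: mem_zspan.
exists [seq val (s i) | i <- index_enum 'I_n]; last by rewrite /word big_map.
rewrite -val_enum_ord (map_comp val s) perm_map //.
apply: uniq_perm; rewrite ?enum_uniq ?(map_inj_uniq perm_inj) ?index_enum_uniq // => i.
by rewrite mem_enum -[i](permKV s) map_f // mem_index_enum.
Qed.

Definition set_one (k : nat) : freeZ -> freeZ :=
  feval (fun i => if i == k then 1 else var i).
HB.instance Definition _ k := GRing.RMorphism.on (set_one k).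

(** Sets [x_k] to 1 and closes the gap in the numbering of the variables, so that
    a multilinear polynomial in [n.+1] variables becomes one in [n] variables. *)
Definition drop_var (k : nat) : freeZ -> freeZ :=
  feval (fun i => if i == k then 1 else var (unbump k i)).
HB.instance Definition _ k := GRing.RMorphism.on (drop_var k).

(** Makes room for a new variable [x_k]. *)
Definition shift_var (k : nat) : freeZ -> freeZ := feval (fun i => var (bump k i)).
HB.instance Definition _ k := GRing.RMorphism.on (shift_var k).

Lemma set_one_var k i : set_one k (var i) = if i == k then 1 else var i.
Proof. exact: feval_var. Qed.

Lemma drop_var_var k i : drop_var k (var i) = if i == k then 1 else var (unbump k i).
Proof. exact: feval_var. Qed.

Lemma shift_var_var k i : shift_var k (var i) = var (bump k i).
Proof. exact: feval_var. Qed.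

Lemma set_oneC j k f : set_one j (set_one k f) = set_one k (set_one j f).
Proof.
rewrite -[LHS]/((set_one j \o set_one k) f) -[RHS]/((set_one k \o set_one j) f).
apply: rmorph_freeZ_eq => i /=; rewrite !set_one_var.
rewrite (fun_if (set_one j)) (fun_if (set_one k)) !rmorph1 !set_one_var.
by case: (i == k); case: (i == j).
Qed.

Lemma set_one_id k f : set_one k (set_one k f) = set_one k f.
Proof.
rewrite -[LHS]/((set_one k \o set_one k) f).
apply: rmorph_freeZ_eq => i /=; rewrite !set_one_var.
by have [ik|ne_ik] := eqVneq i k; rewrite ?rmorph1 // set_one_var (negPf ne_ik).
Qed.

Lemma set_one_drop j k f : (k <= j)%N ->
  set_one j (drop_var k f) = drop_var k (set_one j.+1 f).
Proof.
move=> le_kj.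
rewrite -[LHS]/((set_one j \o drop_var k) f) -[RHS]/((drop_var k \o set_one j.+1) f).
apply: rmorph_freeZ_eq => i /=; rewrite set_one_var drop_var_var.
have [ik|ne_ik] := eqVneq i k.
  have /negPf-> : i != j.+1 by lia.
  by rewrite drop_var_var ik eqxx rmorph1.
rewrite set_one_var; have -> : (unbump k i == j) = (i == j.+1).
  by rewrite /unbump; move: ne_ik; case: ltnP; lia.
by case: eqP => _; rewrite ?rmorph1 // drop_var_var (negPf ne_ik).
Qed.

Lemma set_one_shift j k f : (k <= j)%N ->
  set_one j.+1 (shift_var k f) = shift_var k (set_one j f).
Proof.
move=> le_kj.
rewrite -[LHS]/((set_one j.+1 \o shift_var k) f) -[RHS]/((shift_var k \o set_one j) f).
apply: rmorph_freeZ_eq => i /=; rewrite shift_var_var !set_one_var.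
have -> : (bump k i == j.+1) = (i == j) by rewrite /bump; case: leqP; lia.
by case: eqP => _; rewrite ?rmorph1 // shift_var_var.
Qed.

Lemma set_one_shift_id k f : set_one k (shift_var k f) = shift_var k f.
Proof.
rewrite -[LHS]/((set_one k \o shift_var k) f).
apply: rmorph_freeZ_eq => i /=.
by rewrite shift_var_var set_one_var eq_sym (negPf (neq_bump k i)).
Qed.

Lemma shift_varK k f : drop_var k (shift_var k f) = f.
Proof.
rewrite -[LHS]/((drop_var k \o shift_var k) f) -[RHS]/(idfun f).
apply: rmorph_freeZ_eq => i /=.
by rewrite shift_var_var drop_var_var eq_sym (negPf (neq_bump k i)) bumpK.
Qed.

Lemma drop_varK k f : shift_var k (drop_var k f) = set_one k f.
Proof.
rewrite -[LHS]/((shift_var k \o drop_var k) f).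
apply: rmorph_freeZ_eq => i /=; rewrite drop_var_var set_one_var.
have [ik|ne_ik] := eqVneq i k; first by rewrite rmorph1.
by rewrite shift_var_var unbumpK // inE.
Qed.

Lemma drop_set_one k f : drop_var k (set_one k f) = drop_var k f.
Proof.
rewrite -[LHS]/((drop_var k \o set_one k) f).
apply: rmorph_freeZ_eq => i /=; rewrite set_one_var drop_var_var.
by have [ik|ne_ik] := eqVneq i k; rewrite ?rmorph1 // drop_var_var (negPf ne_ik).
Qed.

Lemma multilinear_ind (n : nat) (P : freeZ -> Prop) :
  P 0 -> (forall x y, P x -> P y -> P (x - y)) ->
  (forall w, perm_eq w (iota 0 n) -> P (word w)) ->
  forall f, f \in multilinear_part n -> P f.
Proof.
move=> P0 PB Pw f /multilinear_partP/asboolP.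
by elim=> [x [w pw ->]|//|x y _ Px _ Py]; [apply: Pw | apply: PB].
Qed.

Lemma drop_var_multilinear n k f : (k <= n)%N ->
  f \in multilinear_part n.+1 -> drop_var k f \in multilinear_part n.
Proof.
move=> le_kn.
apply: (@multilinear_ind _ (fun f => drop_var k f \in multilinear_part n))
  => [|x y Px Py|w pw].
- by rewrite rmorph0 rpred0.
- by rewrite rmorphB rpredB.
have -> : drop_var k (word w) = word [seq unbump k i | i <- w & i != k].
  rewrite /word rmorph_prod big_map big_filter [RHS]big_mkcond /=.
  by apply: eq_bigr => i _; rewrite drop_var_var; case: eqP.
apply: word_multilinear; apply: uniq_perm; rewrite ?iota_uniq //.
  rewrite map_inj_in_uniq ?filter_uniq ?(perm_uniq pw) ?iota_uniq // => i j.
  by rewrite !mem_filter /unbump => /andP[+ _] /andP[+ _]; lia.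
move=> i; rewrite mem_iota /=; apply/mapP/idP => [[j]|lt_in].
  rewrite mem_filter (perm_mem pw) mem_iota /= => /andP[? ?] ->.
  by rewrite /unbump; lia.
exists (bump k i); last by rewrite bumpK.
by rewrite mem_filter (perm_mem pw) mem_iota eq_sym neq_bump /= /bump; lia.
Qed.

Lemma mul_shift_var_multilinear n k f : (k <= n)%N ->
  f \in multilinear_part n -> var k * shift_var k f \in multilinear_part n.+1.
Proof.
move=> le_kn.
apply: (@multilinear_ind _ (fun f => var k * shift_var k f \in multilinear_part n.+1))
  => [|x y Px Py|w pw].
- by rewrite rmorph0 mulr0 rpred0.
- by rewrite rmorphB mulrBr (rpredB Px Py).
have -> : var k * shift_var k (word w) = word (k :: map (bump k) w).
  rewrite /word rmorph_prod big_cons big_map; congr (_ * _).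
  by apply: eq_bigr => i _; apply: shift_var_var.
apply: word_multilinear; apply: uniq_perm; rewrite ?iota_uniq //.
  rewrite /= (map_inj_uniq (can_inj (bumpK k))) (perm_uniq pw) iota_uniq andbT.
  by apply/mapP => -[i _]; apply/eqP; apply: neq_bump.
move=> i; rewrite inE mem_iota /=; apply/idP/idP => [/orP[/eqP->|/mapP[j]]|lt_in].
- by [].
- by rewrite (perm_mem pw) mem_iota /= => ? ->; rewrite /bump; lia.
- have [//|ne_ik] := eqVneq i k; rewrite /=; apply/mapP; exists (unbump k i).
    by rewrite (perm_mem pw) mem_iota /unbump; lia.
  by rewrite unbumpK // inE.
Qed.

(** * Splitting off one variable *)

Definition unit_killed (a b : nat) : {pred freeZ} :=
  fun f => [forall j : 'I_b, set_one (a + j)%N f == 0].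

Fact unit_killed_zmod_closed (a b : nat) : zmod_closed (unit_killed a b).
Proof.
split=> [|f g /forallP f0 /forallP g0]; apply/forallP => j; first by rewrite rmorph0.
by rewrite rmorphB /= (eqP (f0 j)) (eqP (g0 j)) subrr.
Qed.

HB.instance Definition _ (a b : nat) :=
  GRing.isZmodClosed.Build freeZ (unit_killed a b) (unit_killed_zmod_closed a b).

(** These groups interpolate between the multilinear polynomials, [b = 0], and the
    proper ones, [a = 0]: the first [a] variables are arbitrary, while setting any
    of the last [b] variables to 1 gives 0. *)
Definition mixed_part (a b : nat) : zmodClosed freeZ :=
  subgI (multilinear_part (a + b)) (unit_killed a b).

Lemma mixed_partP (a b : nat) (f : freeZ) :
  reflect (f \in multilinear_part (a + b) /\
           forall j, (a <= j < a + b)%N -> set_one j f = 0)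
          (f \in mixed_part a b).
Proof.
apply: (iffP andP) => -[Pf f0]; split=> //.
  move=> j /andP[le_aj lt_jab]; move/forallP: f0.
  have lt_b : (j - a < b)%N by lia.
  by move/(_ (Ordinal lt_b))/eqP => /=; rewrite subnKC.
by apply/forallP => j; apply/eqP; apply: f0; rewrite leq_addr ltn_add2l ltn_ord.
Qed.

(** Unlike [identities], this allows a constant term, which makes it stable under
    substitutions such as [set_one] and lets the degree 0 part be treated like the
    others. *)
Definition vanishing (R : pzRingType) : {pred freeZ} :=
  fun f => `[< forall a : nat -> R, feval a f = 0 >].

Fact vanishing_zmod_closed (R : pzRingType) : zmod_closed (vanishing R).
Proof.
split=> [|f g /asboolP f0 /asboolP g0]; apply/asboolP => a; first exact: rmorph0.
by rewrite rmorphB /= f0 g0 subrr.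
Qed.

HB.instance Definition _ (R : pzRingType) :=
  GRing.isZmodClosed.Build freeZ (vanishing R) (vanishing_zmod_closed R).

Lemma vanishing_feval (R : pzRingType) (v : nat -> freeZ) (f : freeZ) :
  f \in vanishing R -> feval v f \in vanishing R.
Proof. by move=> /asboolP f0; apply/asboolP => a; rewrite feval_feval f0. Qed.

Lemma vanishing_mull (R : pzRingType) (g f : freeZ) :
  f \in vanishing R -> g * f \in vanishing R.
Proof. by move=> /asboolP f0; apply/asboolP => a; rewrite rmorphM /= f0 mulr0. Qed.

(** On polynomials linear in [x_k], the projection onto the kernel of [set_one k]
    along the polynomials [x_k g]. *)
Definition remove_unit (k : nat) (f : freeZ) : freeZ := f - var k * set_one k f.

Lemma remove_unitB k : {morph remove_unit k : f g / f - g}.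
Proof.
by move=> f g; rewrite /remove_unit rmorphB /= mulrBr subrACA.
Qed.

Lemma drop_var_mixed a b f : f \in mixed_part a.+1 b -> drop_var a f \in mixed_part a b.
Proof.
case/mixed_partP=> Pf f0; apply/mixed_partP; split.
  by apply: drop_var_multilinear Pf; apply: leq_addr.
move=> j /andP[le_aj lt_j]; rewrite set_one_drop // f0 ?rmorph0 //.
by rewrite ltnS le_aj addSn ltnS.
Qed.

Lemma remove_unit_mixed a b f :
  f \in mixed_part a.+1 b -> remove_unit a f \in mixed_part a b.+1.
Proof.
move=> Qf; case/mixed_partP: (Qf) => Pf f0; apply/mixed_partP; rewrite addnS; split.
  apply: rpredB Pf _; rewrite -drop_varK; apply: mul_shift_var_multilinear.
    exact: leq_addr.
  by case/mixed_partP: (drop_var_mixed Qf).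
move=> j /andP[le_aj lt_j]; rewrite rmorphB rmorphM /= set_one_var.
have [<-|ne_aj] := eqVneq a j; first by rewrite set_one_id mul1r subrr.
have fj0 : set_one j f = 0 by apply: f0; lia.
by rewrite fj0 set_oneC fj0 rmorph0 mulr0 subrr.
Qed.

Lemma mul_shift_var_mixed a b g :
  g \in mixed_part a b -> var a * shift_var a g \in mixed_part a.+1 b.
Proof.
case/mixed_partP=> Pg g0; apply/mixed_partP; split.
  by apply: mul_shift_var_multilinear Pg; apply: leq_addr.
case=> [//|j] /andP[lt_aj lt_j]; rewrite rmorphM /= set_one_shift // g0.
  by rewrite rmorph0 mulr0.
by rewrite -ltnS lt_aj.
Qed.

Lemma mixed_partS a b f : f \in mixed_part a b.+1 -> f \in mixed_part a.+1 b.
Proof.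
case/mixed_partP=> Pf f0; apply/mixed_partP; rewrite addSnnS.
split=> // j /andP[le_aj lt_j].
by apply: f0; rewrite ltnW.
Qed.

(** The splitting [f = x_a * set_one a f + remove_unit a f] identifies
    [mixed_part a.+1 b] with the product of [mixed_part a b] and
    [mixed_part a b.+1]; the inverse sends [(g, h)] to [x_a * shift_var a g + h].
    Both directions preserve the functions that vanish on [R] because [R] has a
    unit: setting [x_a] to 1 is a legitimate evaluation. *)
Lemma quotient_map_mixed (R : pzRingType) (a b : nat) (A B : zmodType)
    (c : freeZ -> A) (d : freeZ -> B) :
  quotient_map (mixed_part a b) (vanishing R) c ->
  quotient_map (mixed_part a b.+1) (vanishing R) d ->
  quotient_map (mixed_part a.+1 b) (vanishing R)
    (fun f => (c (drop_var a f), d (remove_unit a f)) : (A * B)%type).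
Proof.
move=> [cB cS cH] [dB dS dH]; split=> [f g Qf Qg|[x y]|f Qf].
- rewrite rmorphB /= remove_unitB cB ?drop_var_mixed //.
  by rewrite dB ?remove_unit_mixed.
- have [g Qg <-] := cS x; have [h Qh <-] := dS y.
  have eh0 : set_one a h = 0.
    by case/mixed_partP: Qh => _; apply; rewrite leqnn addnS ltnS leq_addr.
  exists (var a * shift_var a g + h).
    by rewrite rpredD ?mul_shift_var_mixed ?mixed_partS.
  have -> : drop_var a (var a * shift_var a g + h) = g.
    rewrite rmorphD rmorphM /= drop_var_var eqxx mul1r shift_varK.
    by rewrite -[drop_var a h]drop_set_one eh0 rmorph0 addr0.
  have -> // : remove_unit a (var a * shift_var a g + h) = h.
  rewrite /remove_unit rmorphD rmorphM /= set_one_var eqxx mul1r set_one_shift_id eh0.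
  by rewrite addr0 addrC addKr.
- have Qdf := drop_var_mixed Qf; have Qrf := remove_unit_mixed Qf.
  split=> [[/(cH _ Qdf) df /(dH _ Qrf) rf]|If].
    rewrite -[f](subrK (var a * set_one a f)); apply: rpredD rf _.
    rewrite -drop_varK; apply: vanishing_mull; exact: vanishing_feval.
  have If1 : set_one a f \in vanishing R by apply: vanishing_feval.
  congr (_, _); first by apply/(cH _ Qdf); apply: vanishing_feval.
  by apply/(dH _ Qrf); apply: rpredB If _; apply: vanishing_mull.
Qed.

Lemma multilinear_part_fg n :
  exists l : seq freeZ, forall f, f \in multilinear_part n -> f \in seq_span l.
Proof.
exists [seq word w | w <- permutations (iota 0 n)].
set l := map _ _.
apply: (@multilinear_ind _ (fun f => f \in seq_span l)) => [|x y Px Py|w pw].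
- exact: rpred0.
- exact: rpredB Px Py.
by apply: mem_zspan; rewrite map_f // mem_permutations.
Qed.

(** Unrolling the recursion follows the lattice paths of Pascal's triangle. *)
Lemma pascal_sum (m : nat -> nat -> nat) :
  (forall a b, m a.+1 b = m a b + m a b.+1)%N ->
  forall a b, m a b = (\sum_(0 <= j < a.+1) 'C(a, j) * m 0%N (b + j))%N.
Proof.
move=> mS; elim=> [|a IHa] b; first by rewrite big_nat1 bin0 mul1n addn0.
rewrite mS (IHa b) (IHa b.+1) [in RHS]big_nat_recl //.
under [in RHS]eq_bigr do rewrite binS mulnDl.
rewrite big_split [X in (_ + (X + _))%N]big_nat_recr //=.
rewrite [X in (_ + (_ + X * _ + _))%N]bin_small // mul0n !addn0.
rewrite [X in (X + _)%N = _]big_nat_recl // !bin0 addn0 -addnA; congr (_ + (_ + _))%N.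
by apply: eq_bigr => i _; rewrite addSnnS.
Qed.

Section Multiplicities.
Context (R : pzRingType) (q : nat) (hq : zero_or_primepow q).

Definition mixed_codim (a b : nat) : nat :=
  multiplicity (subg_quot (mixed_part a b) (vanishing R)) q.

Lemma mixed_codimS a b :
  mixed_codim a.+1 b = (mixed_codim a b + mixed_codim a b.+1)%N.
Proof.
have [c cP] := quotient_map_subg_quot (mixed_part a b) (vanishing R).
have [d dP] := quotient_map_subg_quot (mixed_part a b.+1) (vanishing R).
have [e eP] := quotient_map_subg_quot (mixed_part a.+1 b) (vanishing R).
have fg a' b' : exists l : seq freeZ,
    forall f, f \in mixed_part a' b' -> f \in seq_span l.
  have [l lP] := multilinear_part_fg (a' + b'); exists l => f /mixed_partP[/lP //].
have [l /(fg_primary_decomposition cP)[s sP]] := fg a b.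
have [l' /(fg_primary_decomposition dP)[t tP]] := fg a b.+1.
rewrite /mixed_codim -(multiplicity_prod hq sP tP).
exact: multiplicity_quotient eP (quotient_map_mixed cP dP).
Qed.

End Multiplicities.

(** * Polynomials killed by setting any variable to 1 are proper *)

Lemma flatten_cons (T : Type) (s : seq T) (ss : seq (seq T)) :
  flatten (s :: ss) = s ++ flatten ss.
Proof. by []. Qed.

Section CommutatorProducts.
Context (F : pzRingType) (x : nat -> F).

Definition comm (f g : F) : F := f * g - g * f.

(** The left normed commutator, with the convention that a single letter is a
    commutator of length 1. Words in variables and products of long commutators
    are then both products [comm_prod]. The ring and the letters are abstract: only
    the substitutions [e k] below are used, never the structure of the free ring. *)
Definition comm_word (w : seq nat) : F :=
  if w is i :: w' then foldl (fun f j => comm f (x j)) (x i) w' else 0.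

Definition comm_prod (ws : seq (seq nat)) : F := \prod_(w <- ws) comm_word w.

Lemma commM f g h : comm (f * g) h = f * comm g h + comm f h * g.
Proof.
by rewrite /comm mulrBr mulrBl !mulrA addrA subrK.
Qed.

Lemma rmorph_comm (phi : {rmorphism F -> F}) f g :
  phi (comm f g) = comm (phi f) (phi g).
Proof. by rewrite rmorphB !rmorphM. Qed.

Lemma comm_word_rcons w j : w != [::] ->
  comm_word (rcons w j) = comm (comm_word w) (x j).
Proof. by case: w => [//|i w] _; rewrite /= -cats1 foldl_cat. Qed.

Lemma comm_word_fixed (phi : {rmorphism F -> F}) w :
  {in w, forall i, phi (x i) = x i} -> phi (comm_word w) = comm_word w.
Proof.
elim/last_ind: w => [|w j IHw] fix_w; first by rewrite rmorph0.
have xj : phi (x j) = x j by apply: fix_w; rewrite mem_rcons mem_head.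
have [->|w_neq0] := eqVneq w [::]; first exact: xj.
rewrite comm_word_rcons // rmorph_comm IHw ?xj // => i iw.
by apply: fix_w; rewrite mem_rcons inE iw orbT.
Qed.

(** A commutator with a central entry vanishes. *)
Lemma comm_word_central (phi : {rmorphism F -> F}) k w :
  (forall f, phi (x k) * f = f * phi (x k)) ->
  (1 < size w)%N -> k \in w -> phi (comm_word w) = 0.
Proof.
move=> cC; elim/last_ind: w => [//|w j IHw].
rewrite size_rcons mem_rcons inE => w_gt0 kwj.
rewrite comm_word_rcons -?size_eq0 -?lt0n // rmorph_comm /comm.
have [<-|ne_kj] := eqVneq k j; first by rewrite cC subrr.
move: kwj; rewrite (negPf ne_kj) /= => kw.
case: w w_gt0 kw IHw => [//|i [|i' w]] _ kw IHw; last first.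
  by rewrite IHw // mul0r mulr0 subrr.
by move: kw; rewrite inE => /eqP <-; rewrite cC subrr.
Qed.

Lemma comm_prod_cat us ws : comm_prod (us ++ ws) = comm_prod us * comm_prod ws.
Proof. exact: big_cat. Qed.

Lemma comm_prod_cons w ws : comm_prod (w :: ws) = comm_word w * comm_prod ws.
Proof. exact: big_cons. Qed.

Lemma comm_prod_fixed (phi : {rmorphism F -> F}) ws :
  {in flatten ws, forall i, phi (x i) = x i} -> phi (comm_prod ws) = comm_prod ws.
Proof.
move=> fix_ws; rewrite /comm_prod rmorph_prod; apply: eq_big_seq => w w_in.
by apply: comm_word_fixed => i iw; apply: fix_ws; apply/flattenP; exists w.
Qed.

Lemma comm_prod_central (phi : {rmorphism F -> F}) k ws :
  (forall f, phi (x k) * f = f * phi (x k)) ->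
  has (fun w => (1 < size w)%N && (k \in w)) ws -> phi (comm_prod ws) = 0.
Proof.
move=> cC; elim: ws => [//|w ws IHws] /=; rewrite comm_prod_cons rmorphM.
case/orP=> [/andP[w_gt1 kw]|/IHws->]; last by rewrite mulr0.
by rewrite (comm_word_central cC) ?mul0r.
Qed.

Definition tail_letter (k : nat) (w : seq nat) : bool :=
  (1 < size w)%N || ((size w == 1%N) && (k <= head 0%N w)%N).

Lemma tail_letterS k w : tail_letter k w -> w != [:: k] -> tail_letter k.+1 w.
Proof.
case: w => [|i [|j w]] //=; rewrite /tail_letter /= => le_ki ne_ik.
by rewrite ltn_neqAle le_ki andbT; apply: contra ne_ik => /eqP->.
Qed.

(** Multilinear products that are words in the variables for [k = 0], and products
    of long commutators for [k = n]. *)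
Definition tail_product (k n : nat) (f : F) : Prop :=
  exists ws, [/\ perm_eq (flatten ws) (iota 0 n), all (tail_letter k) ws
    & f = comm_prod ws].

(** Bracketing with [x_k] is a derivation: it turns a product into a sum of products
    in which one factor [w] has become the long commutator [w, x_k]. The factors
    [us] and [vs] are the context that the induction on [ws] carries along. *)
Lemma tail_commutator k n us ws vs :
  perm_eq (k :: flatten (us ++ ws ++ vs)) (iota 0 n) ->
  all (tail_letter k) (us ++ ws ++ vs) ->
  comm_prod us * comm (comm_prod ws) (x k) * comm_prod vs
    \in zspan (tail_product k.+1 n).
Proof.
elim: ws us => [|w ws IHws] us pk tk.
  rewrite /comm_prod big_nil /comm mul1r mulr1 subrr.
  by rewrite mulr0 mul0r rpred0.
rewrite comm_prod_cons commM mulrDr mulrDl; apply: rpredD.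
  rewrite mulrA; have -> : comm_prod us * comm_word w = comm_prod (rcons us w).
    by rewrite -cats1 comm_prod_cat comm_prod_cons /comm_prod big_nil mulr1.
  by apply: IHws; rewrite cat_rcons.
apply: mem_zspan; exists (us ++ rcons w k :: ws ++ vs).
have w_neq0 : w != [::].
  by move: tk; rewrite all_cat /= => /and3P[_ + _]; case: (w).
split.
- rewrite -(permPr pk); apply/seq.permP => p.
  by rewrite -[k :: flatten _]cat1s -cats1 !(flatten_cat, flatten_cons, count_cat); lia.
- have kN : k \notin flatten (us ++ (w :: ws) ++ vs).
    have: uniq (k :: flatten (us ++ (w :: ws) ++ vs)).
      by rewrite (perm_uniq pk) iota_uniq.
    by case/andP.
  have tk1 : all (tail_letter k.+1) (us ++ (w :: ws) ++ vs).
    apply/allP => u u_in; apply: tail_letterS; first exact: (allP tk).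
    apply: contra kN => /eqP eu; apply/flattenP; exists u => //.
    by rewrite eu mem_head.
  move: tk1; rewrite !all_cat /= all_cat -!andbA => /and4P[-> _ -> ->].
  by rewrite !andbT /tail_letter size_rcons ltnS lt0n size_eq0 w_neq0.
- rewrite comm_prod_cat comm_prod_cons comm_word_rcons // comm_prod_cat.
  by rewrite !mulrA.
Qed.

Context (e : nat -> {rmorphism F -> F}).
Context (eE : forall k i, e k (x i) = if i == k then 1 else x i).

(** If the letter [x_k] is a factor, [f = u x_k v], then [f - x_k u v] is the
    commutator of [u] and [x_k], times [v]. Otherwise [x_k] sits inside a long
    commutator, which dies when [x_k] is set to 1. *)
Lemma tail_remove k n f : (k < n)%N ->
  tail_product k n f -> f - x k * e k f \in zspan (tail_product k.+1 n).
Proof.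
move=> lt_kn [ws [pws tws ->]].
have c1 g : e k (x k) * g = g * e k (x k) by rewrite eE eqxx mul1r mulr1.
have [kws|kNws] := boolP ([:: k] \in ws).
  case/splitPr: kws pws tws => us vs pws tws.
  have pk : perm_eq (k :: flatten (us ++ vs)) (iota 0 n).
    rewrite -(permPr pws) !flatten_cat.
    exact: (permEl (perm_catCA [:: k] (flatten us) (flatten vs))).
  have : k \notin flatten (us ++ vs).
    have: uniq (k :: flatten (us ++ vs)) by rewrite (perm_uniq pk) iota_uniq.
    by case/andP.
  rewrite flatten_cat mem_cat negb_or => /andP[kus kvs].
  have fixE (ts : seq (seq nat)) :
      k \notin flatten ts -> e k (comm_prod ts) = comm_prod ts.
    move=> kts; apply: comm_prod_fixed => i its; rewrite eE.
    by case: eqP kts its => // -> /negPf->.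
  set g := comm_prod (us ++ [:: k] :: vs).
  have -> : g - x k * e k g =
      comm_prod [::] * comm (comm_prod us) (x k) * comm_prod vs.
    rewrite /g comm_prod_cat comm_prod_cons !rmorphM !fixE //= eE eqxx.
    by rewrite /comm [comm_prod [::]]big_nil !mul1r mulrBl !mulrA.
  apply: (@tail_commutator _ _ [::]) pk _.
  by move: tws; rewrite !all_cat /= => /and3P[-> _ ->].
have kf : k \in flatten ws by rewrite (perm_mem pws) mem_iota.
have tl w : w \in ws -> w != [:: k] by move=> w_in; apply: contraNneq kNws => <-.
rewrite (comm_prod_central c1).
  rewrite mulr0 subr0; apply: mem_zspan; exists ws; split=> //.
  by apply/allP => w w_in; apply: tail_letterS; [apply: (allP tws) | apply: tl].
case/flattenP: kf => w w_in kw; apply/hasP; exists w => //; rewrite kw andbT.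
have := allP tws w w_in; have := tl w w_in; case: w kw {w_in} => [|i [|j w]] //.
by rewrite inE => /eqP->; rewrite eqxx.
Qed.

(** A polynomial killed by [e k] is fixed by [f |-> f - x_k * e k f], and
    [tail_remove] eliminates the letter [x_k]; the variables are treated one after
    the other. *)
Lemma tail_span k n f : (k <= n)%N -> f \in zspan (tail_product 0 n) ->
  (forall j, (j < k)%N -> e j f = 0) -> f \in zspan (tail_product k n).
Proof.
move=> + f_in; elim: k => [//|k IHk] lt_kn f0.
have -> : f = f - x k * e k f by rewrite f0 // mulr0 subr0.
have : f \in zspan (tail_product k n).
  by apply: IHk => [|j lt_jk]; [apply: ltnW | apply/f0/ltnW].
move/asboolP; elim=> [g tg||g h _ tg _ th].
- exact: tail_remove.
- by rewrite rmorph0 mulr0 subr0 rpred0.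
- by rewrite rmorphB mulrBr subrACA rpredB.
Qed.

End CommutatorProducts.

Lemma multilinear_tail_span n f :
  f \in multilinear_part n -> f \in zspan (tail_product var 0 n).
Proof.
move/multilinear_partP; apply: zspan_subset => g [w pw ->].
apply: mem_zspan; exists [seq [:: i] | i <- w]; split.
- by rewrite flatten_seq1.
- by apply/allP => u /mapP[i _ ->].
- by rewrite /comm_prod big_map.
Qed.

Lemma has_long_word (k : nat) (ws : seq (seq nat)) :
  all (fun w => 2 <= size w)%N ws -> k \in flatten ws ->
  has (fun w => (1 < size w)%N && (k \in w)) ws.
Proof.
move=> ws2 /flattenP[w w_in kw]; apply/hasP; exists w => //.
by rewrite kw andbT (allP ws2 w w_in).
Qed.

(** A long commutator in which [x_j] occurs is killed by [x_j := 1] as well as by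
    [x_j := 0], and the other ones are fixed by both. So both substitutions agree
    on products of long commutators, even on those that avoid [x_j] and may occur
    in an expression of [f]; but [x_j := 0] kills every multilinear polynomial. *)
Lemma set_one_proper n j f : (j < n)%N -> f \in proper_part n -> set_one j f = 0.
Proof.
move=> lt_jn /andP[Pf Cf].
pose zero : freeZ -> freeZ := feval (fun i => if i == j then 0 else var i).
have zeroE i : zero (var i) = if i == j then 0 else var i by apply: feval_var.
have zeroC h : zero (var j) * h = h * zero (var j).
  by rewrite zeroE eqxx mul0r mulr0.
have -> : set_one j f = zero f.
  move/asboolP: Cf {Pf}; elim=> [_ [ws [_ ws2 ->]]||g h _ eg _ eh].
  - rewrite -[\prod_(w <- ws) _]/(comm_prod var ws).
    have [/(has_long_word ws2) jw|jN] := boolP (j \in flatten ws).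
      transitivity (0 : freeZ).
        apply: (comm_prod_central (k := j) _ jw) => h.
        by rewrite /= set_one_var eqxx mul1r mulr1.
      by apply/esym; apply: (comm_prod_central (k := j) _ jw); apply: zeroC.
    have ne_j i : i \in flatten ws -> i != j by move=> i_in; apply: contraNneq jN => <-.
    transitivity (comm_prod var ws).
      apply: comm_prod_fixed => i /ne_j ne_ij.
      by rewrite /= set_one_var (negPf ne_ij).
    apply/esym; apply: comm_prod_fixed => i /ne_j ne_ij.
    by apply: etrans (zeroE i) _; rewrite (negPf ne_ij).
  - by apply: etrans (rmorph0 _) (esym _); apply: rmorph0.
  - apply: etrans (rmorphB _ _ _) _; rewrite /= eg eh.
    by apply/esym; apply: rmorphB.
move: f Pf {Cf}; apply: multilinear_ind => [|g h eg eh|w pw].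
- exact: rmorph0.
- by apply: etrans (rmorphB _ _ _) _; rewrite -[LHS]/(zero g - zero h) eg eh subrr.
have jw : j \in w by rewrite (perm_mem pw) mem_iota.
case/splitPr: jw {pw} => u v.
have -> : word (u ++ j :: v) = word u * (var j * word v).
  by rewrite /word big_cat big_cons.
transitivity (zero (word u) * (zero (var j) * zero (word v))).
  by rewrite [LHS]rmorphM; congr (_ * _); apply: rmorphM.
by rewrite zeroE eqxx mul0r mulr0.
Qed.

Lemma mixed_part_proper n : (0 < n)%N -> mixed_part 0 n =i proper_part n.
Proof.
move=> n_gt0 f; apply/idP/idP => [/mixed_partP[Pf f0]|Qf]; last first.
  apply/mixed_partP; split=> [|j /andP[_ lt_jn]]; first by case/andP: Qf.
  exact: set_one_proper Qf.
apply/andP; split=> //.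
have := @tail_span _ var (fun k => [the {rmorphism freeZ -> freeZ} of set_one k])
  set_one_var n n f (leqnn n) (multilinear_tail_span Pf) f0.
apply: zspan_subset => g [ws [pws tws ->]]; apply: mem_zspan; exists ws; split=> //.
  by apply: contraTneq n_gt0 => ws0; rewrite -(size_iota 0 n) -(perm_size pws) ws0.
apply/allP => w w_in; have := allP tws w w_in; rewrite /tail_letter.
case: w w_in => [|i [|j w]] //= i_in le_ni.
have : i \in flatten ws by apply/flattenP; exists [:: i]; rewrite ?mem_head.
by rewrite (perm_mem pws) mem_iota ltnNge le_ni.
Qed.

(** * Codimensions *)

Lemma multilinear_identities (R : pzRingType) n f : (0 < n)%N ->
  f \in multilinear_part n -> (f \in vanishing R) = (f \in identities R).
Proof.
move=> n_gt0 Pf; rewrite [RHS]unfold_in.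
have -> // : f@_mone == 0.
apply/eqP; move: f Pf; apply: multilinear_ind => [|x y ex ey|w pw].
- exact: mcoeff0.
- by rewrite mcoeffB ex ey subrr.
have -> : word w = << FMonom w >> by rewrite monomialE.
rewrite mcoeffU1; case: eqP => // e1; move: n_gt0.
by rewrite -(size_iota 0 n) -(perm_size pw) -[w]/(FMonom w : seq nat) e1 fm1.
Qed.

(** For [n = 0] the multilinear polynomials are the integer constants, and
    evaluating them at any point identifies their quotient with the additive group
    generated by the unit of [R]. *)
Lemma mixed_codim0 (R : pzRingType) q n : mixed_codim R q 0 n = proper_codim R n q.
Proof.
have [d dP] := quotient_map_subg_quot (mixed_part 0 n) (vanishing R).
case: n d dP => [|n] d dP; last first.
  have [c cP] := quotient_map_subg_quot (proper_part n.+1) (identities R).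
  have eqG := mixed_part_proper (ltn0Sn n).
  apply: multiplicity_quotient dP _; apply: eq_quotient_map cP => f.
    by rewrite eqG.
  by case/andP=> Pf _; rewrite (multilinear_identities R (ltn0Sn n) Pf).
set G : zmodClosed R := zspan (fun x : R => x = 1).
have P0 f : f \in multilinear_part 0 -> forall a : nat -> R,
    (feval a f \in G) && (feval a f == feval (fun=> 0) f).
  move=> Pf a; move: f Pf; apply: multilinear_ind => [|x y|w].
  - by rewrite !rmorph0 rpred0 eqxx.
  - by rewrite !rmorphB /= => /andP[Gx /eqP ex] /andP[Gy /eqP ey];
      rewrite (rpredB Gx Gy) ex ey eqxx.
  - move/perm_nilP=> ->; rewrite /word big_nil !rmorph1 eqxx andbT.
    exact: mem_zspan.
pose c (f : freeZ) : subg_of G := insubd 0 (feval (fun=> 0) f).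
suff cP : quotient_map (mixed_part 0 0) (vanishing R) c.
  exact: multiplicity_quotient dP cP.
have Q0 f : f \in mixed_part 0 0 -> feval (fun=> 0) f \in G.
  by case/mixed_partP=> /P0/(_ (fun=> 0))/andP[].
split=> [f g Qf Qg|a|f Qf].
- apply: val_inj; rewrite raddfB /= !insubdK ?Q0 ?rpredB //; exact: rmorphB.
- have [f Qf fE] : exists2 f, f \in mixed_part 0 0 & feval (fun=> 0) f = val a.
    have /asboolP := valP a; elim=> [x ->||x y _ [f Qf <-] _ [g Qg <-]].
    + exists 1; last exact: rmorph1.
      apply/mixed_partP; split=> [|j]; last by rewrite ltn0 andbF.
      by have := @word_multilinear 0 [::] isT; rewrite /word big_nil.
    + by exists 0; [exact: rpred0 | exact: rmorph0].
    + by exists (f - g); [exact: rpredB | exact: rmorphB].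
  by exists f => //; apply: val_inj; rewrite insubdK ?fE //; apply: valP.
- split=> [/(congr1 val)|/asboolP f0].
    rewrite /= insubdK ?Q0 // => f0; apply/asboolP => a.
    by case/mixed_partP: Qf => /P0/(_ a)/andP[_ /eqP->].
  by apply: val_inj; rewrite /= insubdK ?f0 // rpred0.
Qed.

Theorem theorem2 (R : pzRingType) (n : nat) (hn : (0 < n)%N)
    (q : nat) (hq : zero_or_primepow q) :
  codim R n q = (\sum_(0 <= j < n.+1) 'C(n, j) * proper_codim R j q)%N.
Proof.
have -> : codim R n q = mixed_codim R q n 0.
  have [c cP] := quotient_map_subg_quot (multilinear_part n) (identities R).
  have [d dP] := quotient_map_subg_quot (mixed_part n 0) (vanishing R).
  apply: multiplicity_quotient cP _; apply: eq_quotient_map dP => f.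
    apply/mixed_partP/idP => [[+ _]|Pf]; rewrite addn0 //.
    by split=> // j /andP[le_nj]; rewrite ltnNge le_nj.
  by case/mixed_partP; rewrite addn0 => Pf _; apply: (multilinear_identities R hn Pf).
rewrite (pascal_sum (mixed_codimS R hq)).
by apply: eq_bigr => j _; rewrite mixed_codim0.
Qed.
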